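(* Let $k\in\mathbb C$ with $\Re(k)>0$ and $\delta>0$. Let $f:\mathbb Q\to\mathbb C$ satisfy $f(x)=f(x+1)$ for all $x\in\mathbb Q\setminus[-1,0]$, and let $h:\mathbb R\setminus\{0\}\to\mathbb C$ satisfy $h(x)=f(x)-|x|^{-k}f(-1/x)$ for $x\in\mathbb Q\setminus\{0\}$, with $h(x)\ll e^{|x|^{-1+\delta}}$ for $x\in(-1,1)\setminus\{0\}$. Then the limit $$f^\ast(x):=\lim_{j\to\infty}q(x_{2j+1})^{-k}f\big(\overline{x_{2j+1}}\big)$$ exists for all $x$ in a subset $X\subset\mathbb R$ of full Lebesgue measure, where $x_{2j+1}=[b_0(x);b_1(x),\dots,b_{2j+1}(x)]$ is the $(2j+1)$-th continued fraction convergent of $x$ and $q(y)$ denotes the denominator of a rational $y$. Moreover, if additionally $f$ is $1$-periodic on all of $\mathbb Q$ and $h(x)=O(|x|^{-\Re(k)})$ for $0<|x|\leq1$, then on $X\setminus\mathbb Q$ this limit coincides with $\lim_{\mathbb Q\ni y=a/q\to x}q^{-k}f(\overline y)$.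
   Context: For a rational $y=a/q$ in reduced form with $q\ge1$, $\overline{y}:=\overline{a}_q/q$ where $\overline a_q\in(0,q]$ satisfies $a\overline a_q\equiv1\pmod q$. $x=[b_0;b_1,b_2,\dots]$ denotes the regular continued fraction expansion. *)

(* Defs.v *)
From HB Require Import structures.
From mathcomp Require Import all_boot all_order all_algebra.
From mathcomp Require Import all_classical all_reals all_analysis.
From mathcomp Require Import complex.
Set Implicit Arguments. Unset Strict Implicit. Unset Printing Implicit Defensive.
Import Order.TTheory GRing.Theory Num.Theory.
Local Open Scope ring_scope.

Section Defs.
Variable R : realType.

Definition cabs (z : R[i]) : R := Num.sqrt (complex.Re z ^+ 2 + complex.Im z ^+ 2).

Definition cpow (r : R) (s : R[i]) : R[i] :=
  let t := complex.Im s * ln r in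
  ((expR (complex.Re s * ln r))%:C * (cos t +i* sin t))%C.

Definition rat2R (y : rat) : R := ratr y.

End Defs.

(* For a in Z and q >= 1: the unique abar in (0, q] with a * abar = 1 mod q
   (0 if none exists, which never happens for coprime a, q). *)
Definition inv_mod (a : int) (q : nat) : nat :=
  head 0%N [seq n <- iota 1 q | ((q%:Z) %| a * n%:Z - 1)%Z].

Definition rbar (y : rat) : rat :=
  (inv_mod (numq y) `|denq y|%N)%:R / (denq y)%:~R.

Definition qden (y : rat) : nat := `|denq y|%N.

Fixpoint cf_val (s : seq int) : rat :=
  match s with
  | [::] => 0
  | [:: b] => b%:~R
  | b :: s' => b%:~R + (cf_val s')^-1
  end.

Section CF.
Variable R : realType.

Definition fracR (t : R) : R := t - (Num.floor t)%:~R.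
Definition gauss_iter (x : R) (n : nat) : R := iter n (fun t => fracR (t^-1)) (fracR x).

Definition cf_digit (x : R) (n : nat) : int :=
  match n with
  | 0 => Num.floor x
  | n'.+1 => Num.floor ((gauss_iter x n')^-1)
  end.

Definition convergent (x : R) (n : nat) : rat :=
  cf_val [seq cf_digit x i | i <- iota 0 n.+1].

Definition fstar_seq (k : R[i]) (f : rat -> R[i]) (x : R) (j : nat) : R[i] :=
  let y := convergent x (2 * j).+1 in
  (cpow (qden y)%:R (- k) * f (rbar y))%C.

Definition cseq_lim (u : nat -> R[i]) (L : R[i]) : Prop :=
  forall eps : R, 0 < eps -> exists N : nat, forall j, (N <= j)%N -> cabs (u j - L)%C < eps.

Definition rat_lim (k : R[i]) (f : rat -> R[i]) (x : R) (L : R[i]) : Prop :=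
  forall eps : R, 0 < eps -> exists d : R, 0 < d /\
    forall y : rat, 0 < `|rat2R R y - x| < d ->
      cabs (cpow (qden y)%:R (- k) * f (rbar y) - L)%C < eps.
End CF.

(* Main.v *)
(* For y = [b_0; b_1, ..., b_n] with n odd, y-bar is
   q_{n-1} / q_n = [0; b_n, ..., b_1].  Alternating the reciprocity x -> -1/x
   with the periodicity of f therefore strips the digits off one by one and yields
     q_n^{-k} f(q_{n-1} / q_n) = f(-1)
       + sum_{m = 1}^{n} q_m^{-k} h((-1)^{m-1} q_{m-1} / q_m).
   Since q_m grows at least like (3/2)^m, the series converges absolutely as soon
   as b_m^{1 - delta} = O(m) with a small constant, and by the Borel-Bernstein
   theorem this holds for almost every x.  If |h(x)| <= C |x|^{-Re k}, the m-th
   term is at most C q_{m-1}^{-Re k}, which makes the tail uniformly small in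
   the digits; since a rational close to an irrational x shares its first digits
   and has an expansion with n odd, the limit along rationals is the same. *)
Require Import Defs.
From HB Require Import structures.
From mathcomp Require Import all_boot all_order all_algebra.
From mathcomp Require Import all_classical all_reals all_analysis.
From mathcomp Require Import complex ring lra.
Set Implicit Arguments. Unset Strict Implicit. Unset Printing Implicit Defensive.
Import Order.TTheory GRing.Theory Num.Theory numFieldNormedType.Exports.
Local Open Scope ring_scope.

(** * Continued fractions and continuants *)

Fixpoint continuant (b : nat -> int) (u v : int) (n : nat) : int :=
  match n with
  | 0 => u
  | m.+1 => match m with
            | 0 => v
            | l.+1 => b m * continuant b u v m + continuant b u v l
            end
  end.

(* Indices are shifted by one: [cfnum b n.+1 / cfden b n.+1] is the convergent
   p_n / q_n = [b_0; b_1, ..., b_n], and [cfden b 0 = 0] is q_{-1}. *)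
Definition cfnum (b : nat -> int) := continuant b 1 (b 0).
Definition cfden (b : nat -> int) := continuant b 0 1.

(** The value [s_0; ..., s_{n-1}, z] with last complete quotient z, over any field so that rationals
    and reals are treated alike. *)
Definition cf_tail (F : fieldType) (s : seq int) (z : F) : F :=
  foldr (fun c v => c%:~R + v^-1) z s.

Definition cf_digits (b : nat -> int) := forall j, 0 < b j.+1.

Lemma continuantSS b u v n :
  continuant b u v n.+2 =
    b n.+1 * continuant b u v n.+1 + continuant b u v n.
Proof. by []. Qed.

Lemma eq_continuant b b' u v n :
  (forall j, (0 < j < n)%N -> b j = b' j) ->
  continuant b u v n = continuant b' u v n.
Proof.
elim/ltn_ind: n => -[|[|n]] // IH e.
rewrite !continuantSS e ?leqnn//.
by rewrite !IH// => j /andP[j0 jn]; apply: e; rewrite j0 ltnW// ltnW.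
Qed.

Section Digits.
Variables (b : nat -> int) (hb : cf_digits b).

Lemma cfdenSS n : cfden b n.+2 = b n.+1 * cfden b n.+1 + cfden b n.
Proof. exact: continuantSS. Qed.

Lemma cfden_ge0_gt0 n : (0 <= cfden b n) && (0 < cfden b n.+1).
Proof.
elim: n => // n /andP[h1 h2]; rewrite (ltW h2) /= cfdenSS.
by rewrite ltr_wpDr// mulr_gt0.
Qed.

Lemma cfden_gt0 n : 0 < cfden b n.+1.
Proof. by have /andP[] := cfden_ge0_gt0 n. Qed.

Lemma cfden_ge0 n : 0 <= cfden b n.
Proof. by have /andP[] := cfden_ge0_gt0 n. Qed.

Lemma cfden_ge_add n : cfden b n.+1 + cfden b n <= cfden b n.+2.
Proof. by rewrite cfdenSS lerD2r ler_peMl ?cfden_ge0// -gtz0_ge1. Qed.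

Lemma cfden_le n : cfden b n <= cfden b n.+1.
Proof.
case: n => // n; apply: le_trans (cfden_ge_add n).
by rewrite lerDl cfden_ge0.
Qed.

Lemma cfden_lt n : cfden b n.+2 < cfden b n.+3.
Proof.
apply: lt_le_trans (cfden_ge_add n.+1).
by rewrite ltrDl cfden_gt0.
Qed.

Lemma cf_det n :
  cfnum b n.+1 * cfden b n - cfnum b n * cfden b n.+1 = (-1) ^+ n.+1.
Proof.
elim: n => [|n IH]; first by rewrite /cfnum /cfden /=; ring.
rewrite cfdenSS /cfnum continuantSS exprS -IH /cfnum; ring.
Qed.

(** The recurrence dominates Fibonacci's, and a = 3/2 satisfies a^2 <= a + 1; the factor 3/2 on the
    right absorbs the case q_0 = q_1 = 1. *)
Lemma cfden_growth (F : realFieldType) n :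
  (3 / 2) ^+ n <= 3 / 2 * (cfden b n.+1)%:~R :> F.
Proof.
elim/ltn_ind: n => -[|[|n]] IH.
- by rewrite expr0 /cfden/= mulr1; lra.
- rewrite expr1 ler_peMr//.
  by rewrite ler1z -gtz0_ge1 cfden_gt0.
- have h0 := IH n (ltnW (ltnSn _)); have h1 := IH n.+1 (ltnSn _).
  have : (cfden b n.+2 + cfden b n.+1)%:~R <= (cfden b n.+3)%:~R :> F.
    by rewrite ler_int cfden_ge_add.
  rewrite intrD; move: h1; rewrite !exprS; move: h0.
  have : 0 <= (3 / 2) ^+ n :> F by apply: exprn_ge0; lra.
  lra.
Qed.

Lemma cf_tail_mkseq (F : realFieldType) n (z : F) : 0 < z ->
  cf_tail (mkseq b n.+1) z =
  (z * (cfnum b n.+1)%:~R + (cfnum b n)%:~R) /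
  (z * (cfden b n.+1)%:~R + (cfden b n)%:~R).
Proof.
elim: n z => [|n IH] z z0.
  rewrite /cf_tail /cfnum /cfden /=; field; exact: lt0r_neq0.
rewrite mkseqS /cf_tail foldr_rcons -/(cf_tail _ _).
have b0 : 0 < (b n.+1)%:~R :> F by rewrite ltr0z.
rewrite IH; last by rewrite addr_gt0 ?invr_gt0.
have q1 : 0 < (cfden b n.+1)%:~R :> F by rewrite ltr0z cfden_gt0.
have q0 : 0 <= (cfden b n)%:~R :> F by rewrite ler0z cfden_ge0.
rewrite cfdenSS /cfnum continuantSS !(intrD, intrM).
have d1 : z * ((b n.+1)%:~R * (cfden b n.+1)%:~R + (cfden b n)%:~R) +
   (cfden b n.+1)%:~R != 0.
  apply: lt0r_neq0; apply: ltr_wpDl => //.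
  by rewrite mulr_ge0 ?addr_ge0 ?mulr_ge0 //; exact: ltW.
by field; rewrite d1 lt0r_neq0// andbT.
Qed.

End Digits.

Lemma cf_val_rcons s c : cf_val (rcons s c) = cf_tail s c%:~R.
Proof.
elim: s => // a s IH; rewrite /cf_tail /= -/(cf_tail _ _) -IH.
by case: s {IH}.
Qed.

Lemma cf_val_mkseq b n : cf_digits b ->
  cf_val (mkseq b n.+1) = (cfnum b n.+1)%:~R / (cfden b n.+1)%:~R.
Proof.
move=> hb; rewrite mkseqS cf_val_rcons; case: n => [|n].
  by rewrite /cfnum /cfden /cf_tail /= divr1.
rewrite cf_tail_mkseq ?ltr0z//.
by rewrite cfdenSS /cfnum continuantSS !(intrD, intrM).
Qed.

(** Two inverses r and m satisfy m - r = r (a m - 1) - m (a r - 1), so q divides their difference,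
    and (0, q] leaves no room for distinct ones. *)
Lemma inv_mod_unique (a : int) (q r : nat) :
  (0 < r <= q)%N -> (q%:Z %| a * r%:Z - 1)%Z -> inv_mod a q = r.
Proof.
move=> /andP[r0 rq] hr; rewrite /inv_mod.
set s := [seq _ <- _ | _].
have rs : r \in s by rewrite mem_filter hr mem_iota r0 add1n ltnS rq.
have : head 0%N s \in s by case: s rs => // x s _; rewrite mem_head.
move: (head 0%N s) => m; rewrite mem_filter mem_iota add1n ltnS.
move=> /andP[hm /andP[m0 mq]].
have hd : (q%:Z %| m%:Z - r%:Z)%Z.
  have -> : m%:Z - r%:Z = r%:Z * (a * m%:Z - 1) - m%:Z * (a * r%:Z - 1) by ring.
  by rewrite rpredB ?dvdz_mull.
apply/eqP; rewrite eqn_leq; move: hd m0 mq r0 rq {hm hr rs s}.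
wlog : m r / (r <= m)%N => [W|rm].
  move=> hd m0 mq r0 rq; case/orP: (leq_total r m) => h; first exact: W.
  by rewrite andbC; apply: W => //; rewrite -opprB rpredN.
rewrite subzn// => hd m0 mq r0 rq; rewrite rm andbT -subn_eq0.
case: posnP => // h; have := dvdn_leq h hd.
by rewrite leqNgt (leq_trans _ mq)// ltn_subrL r0.
Qed.

Lemma rat_reduced (a q : int) : 0 < q -> coprimez a q ->
  numq (a%:~R / q%:~R) = a /\ denq (a%:~R / q%:~R) = q.
Proof.
move=> q0 cop; have q0' : q != 0 by rewrite lt0r_neq0.
by rewrite coprimeq_num// coprimeq_den// gtr0_sg// mul1r gtr0_norm// (negPf q0').
Qed.

(** * Convergents in lowest terms *)

Section Reduced.
Variables (b : nat -> int) (hb : cf_digits b) (n : nat).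
Let y : rat := (cfnum b n.+1)%:~R / (cfden b n.+1)%:~R.

(** The determinant [cf_det] is, up to sign, a Bezout relation. *)
Lemma cf_coprime : coprimez (cfnum b n.+1) (cfden b n.+1).
Proof.
apply/coprimezP.
exists ((-1) ^+ n.+1 * cfden b n, - (-1) ^+ n.+1 * cfnum b n) => /=.
transitivity ((-1) ^+ n.+1 * ((-1) ^+ n.+1) : int); last first.
  by rewrite -exprD addnn -signr_odd odd_double.
by rewrite -{3}(cf_det b n); ring.
Qed.

Lemma qden_cf : qden y = `|cfden b n.+1|%N.
Proof. by rewrite /qden (rat_reduced (cfden_gt0 hb n) cf_coprime).2. Qed.

(* For odd n, p_n q_{n-1} - p_{n-1} q_n = 1, so q_{n-1} inverts p_n mod q_n. *)
Lemma rbar_cf : odd n -> rbar y = (cfden b n)%:~R / (cfden b n.+1)%:~R.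
Proof.
move=> n1; rewrite /rbar.
have [-> ->] := rat_reduced (cfden_gt0 hb n) cf_coprime.
have n0 : 0 < cfden b n by case: (n) n1 => // m _; exact: cfden_gt0.
rewrite (@inv_mod_unique _ _ `|cfden b n|%N).
- by rewrite -[in RHS](gtz0_abs n0).
- rewrite absz_gt0 lt0r_neq0//= -lez_nat !gtz0_abs ?cfden_le//.
  exact: cfden_gt0.
- rewrite !gtz0_abs ?cfden_gt0//; apply/dvdzP; exists (cfnum b n).
  have := cf_det b n; rewrite exprS -signr_odd n1 expr1 => h.
  by rewrite -[X in _ - X](_ : (-1) * (-1) = 1 :> int)// -h; ring.
Qed.

End Reduced.

(** * Telescoping along the continued fraction *)

Section ComplexModulus.
Variable R : realType.
Implicit Types (z w : R[i]) (r s : R).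

Lemma cabsE z : cabs z = ComplexField.Normc.normc z.
Proof. by case: z. Qed.

Lemma cabs_ge0 z : 0 <= cabs z.
Proof. exact: sqrtr_ge0. Qed.

Lemma cabsM z w : cabs (z * w) = cabs z * cabs w.
Proof. by rewrite !cabsE ComplexField.Normc.normcM. Qed.

Lemma cabsD z w : cabs (z + w) <= cabs z + cabs w.
Proof. by rewrite !cabsE le_normcD. Qed.

Lemma cabs_sum (I : Type) (s : seq I) (F : I -> R[i]) :
  cabs (\sum_(i <- s) F i) <= \sum_(i <- s) cabs (F i).
Proof.
elim/big_rec2: _ => [|i x z _ le].
  by rewrite cabsE ComplexField.Normc.normc0.
by apply: le_trans (cabsD _ _) _; rewrite lerD2l.
Qed.

Lemma cabs_bounds z : `|complex.Re z| <= cabs z /\ `|complex.Im z| <= cabs z.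
Proof.
by rewrite -!sqrtr_sqr; split; apply: ler_wsqrtr; rewrite ?lerDl ?lerDr sqr_ge0.
Qed.

Lemma cabs_le_ReIm z : cabs z <= `|complex.Re z| + `|complex.Im z|.
Proof.
rewrite -[leRHS]ger0_norm ?addr_ge0// -sqrtr_sqr; apply: ler_wsqrtr.
rewrite sqrrD !real_normK ?num_real// lerD2r lerDl.
by rewrite mulrn_wge0// mulr_ge0.
Qed.

Lemma cabs_cpow r (s : R[i]) : 0 < r -> cabs (cpow r s) = r `^ complex.Re s.
Proof.
move=> r0; rewrite /powR gt_eqF// /cpow; set e := expR _; set t := _ * ln r.
rewrite cabsM !cabsE /= expr0n addr0 sqrtr_sqr cos2Dsin2 sqrtr1 mulr1.
by rewrite ger0_norm// expR_ge0.
Qed.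

Lemma cpow1 (s : R[i]) : cpow 1 s = 1.
Proof. by rewrite /cpow ln1 !mulr0 expR0 cos0 sin0 mul1r. Qed.

Lemma cpowM r t (s : R[i]) : 0 < r -> 0 < t ->
  cpow (r * t) s = cpow r s * cpow t s.
Proof.
move=> r0 t0; rewrite /cpow lnM// !mulrDr expRD cosD sinD.
by apply/eqP; rewrite eq_complex /=; apply/andP; split; apply/eqP; ring.
Qed.

End ComplexModulus.

(** * The telescoped sum *)

Section Telescoping.
Variables (R : realType) (k : R[i]) (f : rat -> R[i]) (h : R -> R[i]).
Variable b : nat -> int.
Hypothesis periodic : forall x : rat, ~ (-1 <= x <= 0) -> f x = f (x + 1).
Hypothesis reciprocity : forall x : rat, x != 0 ->
  h (rat2R R x) = f x - cpow `|rat2R R x| (- k) * f (- x^-1).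
Hypothesis hb : cf_digits b.

(** The argument (-1)^n q_n / q_{n+1} of [h] in the term m = n + 1. The field is left free because
    [f] takes it as a rational and [h] as a real. *)
Definition cf_ratio (F : fieldType) n : F :=
  (-1) ^+ n * ((cfden b n.+1)%:~R / (cfden b n.+2)%:~R).

Definition cf_term n : R[i] :=
  cpow (cfden b n.+2)%:~R (- k) * h (cf_ratio R n).

Definition cf_sum n : R[i] := f (-1) + \sum_(0 <= i < n) cf_term i.

(** Periodicity is applied only at points above 0 (n even) or below -1 (n odd), where it is
    available; r > 0 is what keeps -(m + 1 + r) < -1. *)
Lemma periodic_shift n m (r : rat) : 0 < r ->
  f ((-1) ^+ n * (m%:R + r)) = f ((-1) ^+ n * r).
Proof.
move=> r0; rewrite -signr_odd; elim: m => [|m IH]; first by rewrite add0r.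
have s0 : 0 < m%:R + r by rewrite ltr_wpDl.
rewrite -natr1 -IH; case: (odd n); rewrite /= ?expr0 ?expr1 ?mul1r ?mulN1r.
  by rewrite periodic; [congr f; ring | case/andP; lra].
by rewrite [RHS]periodic; [congr f; ring | case/andP; lra].
Qed.

Lemma cf_partial_sum n :
  cpow (cfden b n.+2)%:~R (- k) * f (cf_ratio rat n) = cf_sum n.+1.
Proof.
have q0 (F : realFieldType) m : 0 < (cfden b m.+1)%:~R :> F.
  by rewrite ltr0z cfden_gt0.
(* With x the ratio at m, |x| q_{m+1} = q_m, and -1/x is (-1)^{m+1} (b_{m+1} + q_{m-1} / q_m) by the
   recurrence. *)
have rec m : cpow (cfden b m.+2)%:~R (- k) * f (cf_ratio rat m) = cf_term m +
   cpow (cfden b m.+1)%:~R (- k) *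
     f ((-1) ^+ m.+1 * ((b m.+1)%:~R + (cfden b m)%:~R / (cfden b m.+1)%:~R)).
  have x0 : cf_ratio rat m != 0.
    by rewrite /cf_ratio mulf_neq0 ?signr_eq0// lt0r_neq0 ?divr_gt0 ?q0.
  have := reciprocity x0.
  have -> : rat2R R (cf_ratio rat m) = cf_ratio R m.
    by rewrite /rat2R /cf_ratio rmorphM rmorph_sign /= fmorph_div /= !ratr_int.
  rewrite /cf_term => ->.
  have -> : (cfden b m.+1)%:~R =
      (cfden b m.+2)%:~R * `|cf_ratio R m| :> R.
    rewrite /cf_ratio normrM normr_sign mul1r gtr0_norm ?divr_gt0 ?q0//.
    by rewrite mulrC mulfVK// lt0r_neq0 ?q0.
  rewrite cpowM ?q0//; last first.
    rewrite /cf_ratio normrM normr_sign mul1r normr_gt0.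
    by rewrite lt0r_neq0 ?divr_gt0 ?q0.
  set u := f (- _); have -> : u = f ((-1) ^+ m.+1 *
     ((b m.+1)%:~R + (cfden b m)%:~R / (cfden b m.+1)%:~R)).
    congr f; rewrite /cf_ratio cfdenSS intrD intrM invfM invr_sign.
    rewrite invf_div exprS.
    by field; rewrite !lt0r_neq0 ?q0.
  by rewrite mulrBr mulrA subrK.
have bE m (F : fieldType) : (b m.+1)%:~R = `|b m.+1|%N%:R :> F.
  by rewrite -[in LHS](gtz0_abs (hb m)).
elim: n => [|n IH].
  rewrite rec /cf_sum big_nat1 addrC; congr (_ + _).
  rewrite /cfden /= cpow1 mul1r mul0r addr0 bE.
  (* As q_{-1} = 0, the argument is -b_1 = -((b_1 - 1) + 1); it is moved to -1, as far as the
     periodicity reaches. *)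
  rewrite -(prednK (n := `|b 1|)); last first.
    by rewrite absz_gt0 lt0r_neq0.
  by rewrite -natr1 periodic_shift// expr1 mulr1.
rewrite rec /cf_sum big_nat_recr//= addrA -/(cf_sum n.+1) -IH addrC.
congr (_ + _).
rewrite bE periodic_shift ?divr_gt0 ?q0//.
by rewrite exprS exprS mulrA mulrNN mul1r.
Qed.

(** At the odd index 2n + 1, [rbar y] is q_{2n} / q_{2n+1}, which is [cf_ratio] at 2n because the
    sign is +1 there. *)
Lemma fstar_value n (y : rat) :
  y = (cfnum b n.*2.+2)%:~R / (cfden b n.*2.+2)%:~R ->
  cpow (qden y)%:R (- k) * f (rbar y) = cf_sum n.*2.+1.
Proof.
move=> ->; rewrite qden_cf// rbar_cf//= ?odd_double//.
rewrite -cf_partial_sum /cf_ratio -signr_odd odd_double mul1r.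
by rewrite pmulrn gtz0_abs// cfden_gt0.
Qed.

End Telescoping.

(** * Cylinders and the Gauss map *)

Section Cylinder.
Variables (F : realFieldType) (b : nat -> int).
Hypothesis hb : cf_digits b.

(* The open interval between [b_0; ..., b_n] and [b_0; ..., b_n + 1]. *)
Definition cylinder n : pred F := fun y =>
  0 < (-1) ^+ n * (y - (cfnum b n.+1)%:~R / (cfden b n.+1)%:~R)
    < ((cfden b n.+1)%:~R * ((cfden b n.+1)%:~R + (cfden b n)%:~R))^-1.

(** Here t is the remaining tail and 1/t the complete quotient; the determinant reduces the
    numerator to t up to sign. *)
Lemma cf_tail_dist n (t : F) : 0 < t ->
  cf_tail (mkseq b n.+1) t^-1 - (cfnum b n.+1)%:~R / (cfden b n.+1)%:~R =
  (-1) ^+ n *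
    (t / ((cfden b n.+1)%:~R * ((cfden b n.+1)%:~R + t * (cfden b n)%:~R))).
Proof.
move=> t0; rewrite cf_tail_mkseq ?invr_gt0//.
have q1 : 0 < (cfden b n.+1)%:~R :> F by rewrite ltr0z cfden_gt0.
have q0 : 0 <= (cfden b n)%:~R :> F by rewrite ler0z cfden_ge0.
have -> : (-1) ^+ n = (cfnum b n)%:~R * (cfden b n.+1)%:~R -
                      (cfnum b n.+1)%:~R * (cfden b n)%:~R :> F.
  rewrite -!intrM -intrB -opprB cf_det exprS mulN1r opprK.
  by rewrite rmorphXn rmorphN1.
have d0 : 0 < (cfden b n.+1)%:~R + t * (cfden b n)%:~R :> F.
  by rewrite ltr_wpDr// mulr_ge0// ltW.
by field; rewrite !lt0r_neq0// addrC.
Qed.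

(** The distance in [cf_tail_dist] increases from 0 to 1 / (q_n (q_n + q_{n-1})) as t runs through
    (0, 1). *)
Lemma cylinderP n y :
  cylinder n y <-> exists2 t, 0 < t < 1 & y = cf_tail (mkseq b n.+1) t^-1.
Proof.
rewrite /cylinder.
have q1 : 0 < (cfden b n.+1)%:~R :> F by rewrite ltr0z cfden_gt0.
have q0 : 0 <= (cfden b n)%:~R :> F by rewrite ler0z cfden_ge0.
split=> [|[t /andP[t0 t1] ->]]; last first.
  rewrite cf_tail_dist// signrMK.
  have tq : 0 <= t * (cfden b n)%:~R :> F by rewrite mulr_ge0// ltW.
  rewrite divr_gt0 ?mulr_gt0 ?ltr_wpDr//=.
  rewrite ltr_pdivrMr ?mulr_gt0 ?ltr_wpDr// mulrC ltr_pdivlMr; last first.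
    by rewrite mulr_gt0 ?ltr_wpDr.
  rewrite mulrCA ltr_pM2l// mulrDr ltrD2r; move: t1.
  by rewrite -(ltr_pM2r q1) mul1r.
have yE : y = (cfnum b n.+1)%:~R / (cfden b n.+1)%:~R +
  (-1) ^+ n * ((-1) ^+ n * (y - (cfnum b n.+1)%:~R / (cfden b n.+1)%:~R)).
  by rewrite signrMK addrC subrK.
move: yE; set d := (-1) ^+ n * (y - _) => yE /andP[d0 d1].
set Q := (cfden b n.+1)%:~R in q1 d1 *; set Q' := (cfden b n)%:~R in q0 d1 *.
have d2 : d * Q * Q + d * Q * Q' < 1.
  move: d1; rewrite -[X in _ < X]mul1r ltr_pdivlMr; last first.
    by rewrite mulr_gt0 ?ltr_wpDr.
  by rewrite mulrA mulrDr.
have dQ : 0 < d * Q * Q by do 2?apply: mulr_gt0.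
have w0 : 0 < 1 - d * Q * Q' by lra.
(* The solution t of d = t / (Q (Q + t Q')). *)
exists (d * Q * Q / (1 - d * Q * Q')).
  by rewrite divr_gt0//= ltr_pdivrMr// mul1r; lra.
set t := d * Q * Q / _; have t0 : 0 < t by rewrite divr_gt0.
have /eqP := cf_tail_dist n t0; rewrite subr_eq => /eqP ->.
rewrite {1}yE addrC -/Q; congr (_ * _ + _).
rewrite -/Q -/Q' /t; field; rewrite lt0r_neq0//=.
apply: lt0r_neq0; rewrite -/Q -/Q' ltr_wpDr ?mulr_gt0//.
by rewrite mulr_ge0// ltW.
Qed.

End Cylinder.

(** * Uniqueness of the digits *)

Section TailInjectivity.
Variable F : realFieldType.

Lemma cf_tail_gt1 s (z : F) :
  all (fun c => 0 < c) s -> 1 < z -> 1 < cf_tail s z.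
Proof.
elim: s => //= c s IH /andP[c0 s0] z1; have := IH s0 z1.
rewrite /cf_tail /= -/(cf_tail _ _) => v1.
apply: (@le_lt_trans _ _ c%:~R); first by rewrite ler1z -gtz0_ge1.
by rewrite ltrDl invr_gt0 (lt_trans _ v1).
Qed.

Lemma cf_tail_cons_bounds c s (z : F) : all (fun c => 0 < c) s -> 1 < z ->
  c%:~R < cf_tail (c :: s) z < (c + 1)%:~R.
Proof.
move=> s0 z1; have v1 := cf_tail_gt1 s0 z1.
rewrite /cf_tail /= -/(cf_tail _ _) intrD.
by rewrite ltrDl ltrD2l invr_gt0 invf_lt1 (lt_trans _ v1).
Qed.

(** The first digit is the integer part, by [cf_tail_cons_bounds]; cancelling it leaves equal
    shorter tails. The condition z > 1 excludes the ambiguity c = (c - 1) + 1/1. *)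
Lemma cf_tail_inj c c' s s' (z z' : F) :
  size s = size s' -> all (fun c => 0 < c) s -> all (fun c => 0 < c) s' ->
  1 < z -> 1 < z' -> cf_tail (c :: s) z = cf_tail (c' :: s') z' ->
  c :: s = c' :: s'.
Proof.
move=> + + + z1 z1'.
have step d d' r r' : all (fun c => 0 < c) r -> all (fun c => 0 < c) r' ->
    cf_tail (d :: r) z = cf_tail (d' :: r') z' ->
    d = d' /\ cf_tail r z = cf_tail r' z'.
  move=> r0 r0' e.
  have /andP[l u] := cf_tail_cons_bounds d r0 z1.
  have /andP[l' u'] := cf_tail_cons_bounds d' r0' z1'.
  have dd : d = d'.
    rewrite e in l u; apply/eqP; rewrite eq_le -!ltzD1 -!(ltr_int F).
    by rewrite (lt_trans l)// (lt_trans l').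
  split=> //; move: e; rewrite dd /cf_tail /=.
  by move=> /addrI/invr_inj.
elim: s s' c c' => [|a s IH] [|a' s'] c c' // sz s0 s0' e.
  by have [->] := step c c' [::] [::] isT isT e.
have [-> e'] := step c c' (a :: s) (a' :: s') s0 s0' e.
case: sz => sz; case/andP: s0 => _ s0; case/andP: s0' => _ s0'.
by rewrite (IH s' a a').
Qed.

Lemma mkseq_cons (b : nat -> int) n :
  mkseq b n.+1 = b 0 :: [seq b i | i <- iota 1 n].
Proof. by []. Qed.

Lemma all_digits b m n : cf_digits b ->
  all (fun c => 0 < c) [seq b i | i <- iota m.+1 n].
Proof.
move=> hb; apply/allP => _ /mapP[i + ->]; rewrite mem_iota.
by case: i => // i _; exact: hb.
Qed.

Lemma cylinder_in_unit b n (y : F) : cf_digits b ->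
  cylinder b n y -> (b 0)%:~R < y < (b 0 + 1)%:~R.
Proof.
move=> hb /(cylinderP hb)[t /andP[t0 t1] ->]; apply: cf_tail_cons_bounds.
  exact: all_digits.
by rewrite invf_gt1.
Qed.

Lemma cylinder_inj b b' n (y : F) : cf_digits b -> cf_digits b' ->
  cylinder b n y -> cylinder b' n y -> mkseq b n.+1 = mkseq b' n.+1.
Proof.
move=> hb hb' /(cylinderP hb)[t /andP[t0 t1] ->].
move=> /(cylinderP hb')[t' /andP[t0' t1']].
rewrite !mkseq_cons => /cf_tail_inj -> //; rewrite ?invf_gt1 ?all_digits//.
by rewrite !size_map !size_iota.
Qed.

End TailInjectivity.

(** * Digits from the Gauss map *)

Section GaussMap.
Variable R : realType.
Implicit Type x : R.

Lemma irrational_fracR x : irrational x -> irrational (fracR x).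
Proof.
apply: contra_not => -[q _ e]; exists (q + (Num.floor x)%:~R) => //.
have -> : ratr (q + (Num.floor x)%:~R) = ratr q + (Num.floor x)%:~R :> R.
  by rewrite rmorphD /= ratr_int.
by rewrite e /fracR subrK.
Qed.

Lemma irrational_inv x : irrational x -> irrational x^-1.
Proof.
by apply: contra_not => -[q _ e]; exists q^-1; rewrite // fmorphV /= e invrK.
Qed.

Lemma fracR_bounds x : irrational x -> 0 < fracR x < 1.
Proof.
move=> ix; have /andP[l u] := floor_itv x.
rewrite intrD in u.
rewrite /fracR subr_gt0 lt_neqAle l andbT ltrBlDl u andbT.
apply/negP => /eqP e; apply: ix; exists (Num.floor x)%:~R => //.
by rewrite ratr_int.
Qed.

Lemma gauss_iterS x n : gauss_iter x n.+1 = fracR (gauss_iter x n)^-1.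
Proof. by []. Qed.

Lemma irrational_gauss_iter x n : irrational x -> irrational (gauss_iter x n).
Proof.
move=> ix; elim: n => [|n IH]; first exact: irrational_fracR.
by rewrite gauss_iterS; apply: irrational_fracR; exact: irrational_inv.
Qed.

Lemma gauss_iter_bounds x n : irrational x -> 0 < gauss_iter x n < 1.
Proof.
case: n => [|n] ix; apply: fracR_bounds => //.
by apply: irrational_inv; exact: irrational_gauss_iter.
Qed.

Lemma cf_digitS x n :
  (gauss_iter x n)^-1 = (cf_digit x n.+1)%:~R + gauss_iter x n.+1.
Proof. by rewrite gauss_iterS /fracR addrC subrK. Qed.

Lemma cf_digit_digits x : irrational x -> cf_digits (cf_digit x).
Proof.
move=> ix j; have /andP[t0 t1] := gauss_iter_bounds j ix.
by rewrite /= floor_gt0 ltW// invf_gt1.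
Qed.

(** Iterates 1/t_n = b_{n+1} + t_{n+1} for the Gauss iterates t_n; the complete quotient after b_n
    is 1/t_n. *)
Lemma cf_tail_digits x n :
  x = cf_tail (mkseq (cf_digit x) n.+1) (gauss_iter x n)^-1.
Proof.
elim: n => [|n IH].
  by rewrite /cf_tail /= invrK /gauss_iter /= /fracR addrC subrK.
by rewrite mkseqS /cf_tail foldr_rcons invrK -cf_digitS -/(cf_tail _ _) -IH.
Qed.

Lemma cylinder_digits x n : irrational x -> cylinder (cf_digit x) n x.
Proof.
move=> ix; apply/(cylinderP (cf_digit_digits ix)).
exists (gauss_iter x n); [exact: gauss_iter_bounds | exact: cf_tail_digits].
Qed.

End GaussMap.

(** * The Borel-Bernstein theorem *)

Section SmallTails.
Variable R : realType.
Local Open Scope classical_set_scope.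
Local Notation mu := (@lebesgue_measure R).

(* The entries of [s] are the digits minus one, so any [s] is admissible. *)
Definition seq_digits (i : int) (s : seq nat) (j : nat) : int :=
  if j is l.+1 then (nth 0%N s l).+1%:Z else i.

Lemma seq_digitsP i s : cf_digits (seq_digits i s).
Proof. by []. Qed.

(* A neighbourhood of [b_0; ..., b_n] containing [b_0; ..., b_n + t] for all
   t <= e. *)
Definition tail_nbhd (b : nat -> int) n (e : R) : set R :=
  [set y | `|y - (cfnum b n.+1)%:~R / (cfden b n.+1)%:~R|
           <= e / (cfden b n.+1)%:~R ^+ 2].

(* [pickle_inv] is injective where it is defined, so that the sets indexed by
   the codes m of lists of length n are disjoint. *)
Definition indexed_cylinder i n m : set R :=
  if pickle_inv m is Some s then
    if size s == n then [set y | cylinder (seq_digits i s) n y] else set0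
  else set0.

Definition indexed_tail_nbhd i n e m : set R :=
  if pickle_inv m is Some s then
    if size s == n then tail_nbhd (seq_digits i s) n e else set0
  else set0.

Lemma cylinder_measure b n : cf_digits b ->
  measurable [set y | @cylinder R b n y] /\
  mu [set y | @cylinder R b n y] =
    ((cfden b n.+1)%:~R * ((cfden b n.+1)%:~R + (cfden b n)%:~R))^-1%:E.
Proof.
move=> hb; set u : R := (cfnum b n.+1)%:~R / (cfden b n.+1)%:~R.
set w : R := _^-1.
have w0 : 0 < w.
  by rewrite invr_gt0 mulr_gt0 ?ltr_wpDr ?ltr0z ?ler0z ?cfden_gt0 ?cfden_ge0.
have -> : [set y | @cylinder R b n y] =
    if odd n then `]u - w, u[%classic else `]u, u + w[%classic.
  apply/seteqP; split => y; rewrite /= /cylinder -signr_odd -/u -/w;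
    case: (odd n); rewrite /= in_itv /= ?expr0 ?expr1 ?mul1r ?mulN1r;
    by move=> /andP[h1 h2]; apply/andP; split; lra.
split; first by case: (odd n); exact: measurable_itv.
case: (odd n); rewrite lebesgue_measure_itv /= lte_fin.
  by rewrite ltrBlDr ltrDl w0 -EFinB opprB addrC subrK.
by rewrite ltrDl w0 -EFinB addrC addKr.
Qed.

(** The neighbourhood has length 2 e / q_n^2, and the cylinder at least 1 / (2 q_n^2) because
    q_{n-1} <= q_n: hence the factor 4. *)
Lemma tail_nbhd_measure b n (e : R) : cf_digits b -> 0 <= e ->
  measurable (tail_nbhd b n e) /\
  (mu (tail_nbhd b n e) <= (4 * e)%:E * mu [set y | @cylinder R b n y])%E.
Proof.
move=> hb e0; set u : R := (cfnum b n.+1)%:~R / (cfden b n.+1)%:~R.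
rewrite (cylinder_measure n hb).2.
have q1 : 0 < (cfden b n.+1)%:~R :> R by rewrite ltr0z cfden_gt0.
have q0 : 0 <= (cfden b n)%:~R :> R by rewrite ler0z cfden_ge0.
have q01 : (cfden b n)%:~R <= (cfden b n.+1)%:~R :> R.
  by rewrite ler_int cfden_le.
have -> : tail_nbhd b n e =
    `[u - e / (cfden b n.+1)%:~R ^+ 2, u + e / (cfden b n.+1)%:~R ^+ 2]%classic.
  apply/seteqP; split => y; rewrite /tail_nbhd /= in_itv /= -/u ler_distl;
    by move=> /andP[-> ->].
split; first exact: measurable_itv.
set w : R := e / _; have w0 : 0 <= w by rewrite divr_ge0 ?sqr_ge0.
have wle : w + w <= 4 * e *
    ((cfden b n.+1)%:~R * ((cfden b n.+1)%:~R + (cfden b n)%:~R))^-1.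
  have -> : w + w = 4 * e *
      ((cfden b n.+1)%:~R * ((cfden b n.+1)%:~R + (cfden b n.+1)%:~R))^-1.
    by rewrite /w; field; rewrite !lt0r_neq0 ?addr_gt0.
  rewrite ler_wpM2l ?mulr_ge0// lef_pV2 ?posrE; last 2 first.
  - by rewrite mulr_gt0// addr_gt0.
  - by rewrite mulr_gt0// ltr_wpDr.
  by rewrite ler_pM2l// lerD2l.
rewrite lebesgue_measure_itv /= lte_fin -EFinM; case: ifP => _.
  by rewrite -EFinB lee_fin; lra.
by rewrite lee_fin; lra.
Qed.

Lemma indexed_cylinder_measurable i n m : measurable (indexed_cylinder i n m).
Proof.
rewrite /indexed_cylinder; case: pickle_inv => // s; case: ifP => // _.
by have [] := cylinder_measure n (seq_digitsP i s).
Qed.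

Lemma indexed_tail_nbhd_measure i n (e : R) m : 0 <= e ->
  measurable (indexed_tail_nbhd i n e m) /\
  (mu (indexed_tail_nbhd i n e m) <=
     (4 * e)%:E * mu (indexed_cylinder i n m))%E.
Proof.
move=> e0; rewrite /indexed_tail_nbhd /indexed_cylinder.
case: pickle_inv => [s|]; last by rewrite measure0 mule0.
case: ifP => _; last by rewrite measure0 mule0.
exact: tail_nbhd_measure.
Qed.

Lemma indexed_cylinder_disjoint i n : trivIset setT (indexed_cylinder i n).
Proof.
move=> m m' _ _ [y []]; rewrite /indexed_cylinder.
case E : pickle_inv => [s|]//; case: eqP => // sz ys.
case E' : pickle_inv => [s'|]//; case: eqP => // sz' ys'.
have := cylinder_inj (seq_digitsP i s) (seq_digitsP i s') ys ys'.
move=> /(congr1 (fun l => nth 0 l)) e.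
have {}e : s = s'.
  apply: (@eq_from_nth _ 0%N); first by rewrite sz sz'.
  move=> j; rewrite sz => jn.
  by have := congr1 (fun g => g j.+1) e; rewrite !nth_mkseq//= => -[].
by have := pickle_invK (T := seq nat) m; rewrite E /= e;
   have := pickle_invK (T := seq nat) m'; rewrite E' /= => -> ->.
Qed.

(** The cylinders are disjoint and lie in (i, i + 1). *)
Lemma sum_cylinder_measure i n :
  (\sum_(0 <= m <oo) mu (indexed_cylinder i n m) <= 1)%E.
Proof.
rewrite -measure_semi_bigcup//; last 3 first.
- exact: indexed_cylinder_measurable.
- exact: indexed_cylinder_disjoint.
- by apply: bigcupT_measurable => m; exact: indexed_cylinder_measurable.
have -> : 1%E = mu `]i%:~R, (i + 1)%:~R[%classic.
  rewrite lebesgue_measure_itv /= lte_fin ltr_int ltrDl ltr01.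
  by rewrite -EFinB -intrB addrC addKr.
apply: le_measure; rewrite ?inE//.
  by apply: bigcupT_measurable => m; exact: indexed_cylinder_measurable.
move=> y [m _]; rewrite /indexed_cylinder.
case: pickle_inv => // s; case: ifP => // _.
move=> /(cylinder_in_unit (seq_digitsP i s)).
by rewrite /= in_itv.
Qed.

Lemma tail_nbhds_measure i n (e : R) : 0 <= e ->
  measurable (\bigcup_m indexed_tail_nbhd i n e m) /\
  (mu (\bigcup_m indexed_tail_nbhd i n e m) <= (4 * e)%:E)%E.
Proof.
move=> e0.
have mE : measurable (\bigcup_m indexed_tail_nbhd i n e m).
  apply: bigcupT_measurable => m.
  by have [] := indexed_tail_nbhd_measure i n m e0.
split=> //; apply: le_trans.
  apply: (@measure_sigma_subadditive _ _ _ mu _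
    (indexed_tail_nbhd i n e)) => //.
  by move=> m; have [] := indexed_tail_nbhd_measure i n m e0.
apply: (@le_trans _ _
    (\sum_(0 <= m <oo) (4 * e)%:E * mu (indexed_cylinder i n m))%E).
  apply: lee_nneseries => [*|m _]; first exact: measure_ge0.
  by have [] := indexed_tail_nbhd_measure i n m e0.
rewrite nneseriesZl//.
rewrite -[leRHS]mule1; apply: lee_wpmul2l; last exact: sum_cylinder_measure.
by rewrite lee_fin mulr_ge0.
Qed.

(** By [cf_tail_dist], x is at distance t_n / (q_n (q_n + t_n q_{n-1})) from p_n / q_n; dropping t_n
    q_{n-1} bounds it by e / q_n^2. *)
Lemma small_tail_covered (x : R) n e : irrational x -> gauss_iter x n <= e ->
  (\bigcup_m indexed_tail_nbhd (Num.floor x) n e m) x.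
Proof.
move=> ix te; have hb := cf_digit_digits ix.
set s := [seq (`|cf_digit x j|%N).-1 | j <- iota 1 n].
have sE j : (j <= n)%N -> seq_digits (Num.floor x) s j = cf_digit x j.
  case: j => // j jn.
  rewrite /seq_digits /s (nth_map 0%N) ?size_iota// nth_iota//.
  rewrite add1n prednK ?absz_gt0 ?lt0r_neq0 ?hb//.
  by rewrite gtz0_abs.
exists (pickle s) => //.
rewrite /indexed_tail_nbhd pickleK_inv size_map size_iota eqxx /tail_nbhd /=.
rewrite /cfnum /cfden sE//.
rewrite !(@eq_continuant (seq_digits _ s) (cf_digit x)); last 2 first.
- by move=> j /andP[_ jn]; exact: sE.
- by move=> j /andP[_ jn]; exact: sE.
have /andP[t0 t1] := gauss_iter_bounds n ix.
rewrite {1}(cf_tail_digits x n) -/(cfnum _) -/(cfden _) cf_tail_dist//.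
have q1 : 0 < (cfden (cf_digit x) n.+1)%:~R :> R by rewrite ltr0z cfden_gt0.
have q0 : 0 <= (cfden (cf_digit x) n)%:~R :> R by rewrite ler0z cfden_ge0.
have tq : 0 <= gauss_iter x n * (cfden (cf_digit x) n)%:~R.
  by rewrite mulr_ge0// ltW.
rewrite normrM normr_sign mul1r ger0_norm; last first.
  by rewrite divr_ge0 ?mulr_ge0 ?addr_ge0// ltW.
apply: ler_pM => //; rewrite ?invr_ge0 ?mulr_ge0 ?addr_ge0//; try exact: ltW.
rewrite lef_pV2 ?posrE ?exprn_gt0 ?mulr_gt0 ?ltr_wpDr//.
by rewrite expr2 ler_pM2l// lerDl.
Qed.

(* Borel-Bernstein: the tail t_n(x) = [0; b_{n+1}, b_{n+2}, ...] is at most e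
   on a set of measure O(e) in each unit interval, so Borel-Cantelli applies. *)
Lemma negligible_small_tails (e : nat -> R) :
  (forall n, 0 <= e n) -> cvgn (series e) ->
  mu.-negligible (~` [set x | irrational x /\
     exists M, forall n, (M <= n)%N -> e n < gauss_iter x n]).
Proof.
move=> e0 ce.
(* One limsup set per integer part, because the measure bound holds in each unit interval
   separately. *)
pose Z (i : int) :=
  lim_sup_set (fun n => \bigcup_m indexed_tail_nbhd i n (e n) m).
have Z0 i : mu.-negligible (Z i).
  have mE n : measurable (\bigcup_m indexed_tail_nbhd i n (e n) m).
    by have [] := tail_nbhds_measure i n (e0 n).
  exists (Z i); split => //.
    apply: bigcapT_measurable => n.
    by apply: bigcup_measurable => m _; exact: mE.
  apply: lim_sup_set_cvg0 => //.
  apply: (@le_lt_trans _ _ (\sum_(0 <= n <oo) (4 * e n)%:E)%E).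
    apply: lee_nneseries => [*|n _]; first exact: measure_ge0.
    by have [] := tail_nbhds_measure i n (e0 n).
  have -> : (\sum_(0 <= n <oo) (4 * e n)%:E)%E = (limn (series (4 *: e)))%:E.
    rewrite -EFin_lim; last exact: is_cvg_seriesZ.
    by congr (limn _); apply/funext => n; rewrite /= sumEFin.
  exact: ltry.
have cQ : countable (@rational R).
  apply: (sub_countable (card_image_le _ _)); exact: countableP.
have Q0 : mu.-negligible (@rational R).
  exists (@rational R); split => //.
  - exact: countable_measurable.
  - exact: countable_lebesgue_measure0.
suff sub : ~` [set x : R | irrational x /\
     exists M, forall n, (M <= n)%N -> e n < gauss_iter x n] `<=`
   rational `|` (\bigcup_m Z (Posz m) `|` \bigcup_m Z (Negz m)).
  have [] : mu.-negligible
      (rational `|` (\bigcup_m Z (Posz m) `|` \bigcup_m Z (Negz m))).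
    by apply: negligibleU => //; apply: negligibleU; apply: negligible_bigcup.
  by move=> N [mN N0 QN]; exists N; split => //; exact: subset_trans QN.
move=> x /= hx; have [?|ix] := pselect (rational x); [by left|right].
have Zx : Z (Num.floor x) x.
  move=> M _ /=; apply: contrapT => nE; apply: hx; split => //.
  exists M => n Mn; rewrite ltNge; apply/negP => le; apply: nE.
  by exists n => //; exact: small_tail_covered.
by case: (Num.floor x) Zx => m Zx; [left|right]; exists m.
Qed.

End SmallTails.

(** * Convergence of series *)

Section Series.
Variable R : realType.
Local Open Scope classical_set_scope.

(** A telescoping substitute for the integral test. The constant makes the final inequality 1/M <=
    (2 + a) / (M + 1 + a), with M = m + 1, an equality at M = 1. *)
Lemma powR_step (a : R) (m : nat) : 0 < a ->
  m.+1%:R `^ (- (1 + a)) <=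
  (2 + a) / a * (m.+1%:R `^ (- a) - m.+2%:R `^ (- a)).
Proof.
move=> a0; have m0 : 0 < m.+1%:R :> R by rewrite ltr0n.
have m1 : 1 <= m.+1%:R :> R by rewrite ler1n.
set M := m.+1%:R in m0 m1 *.
have -> : m.+2%:R = M * ((M + 1) / M) :> R.
  by rewrite mulrC divfK ?lt0r_neq0// natr1.
have r0 : 0 < (M + 1) / M by rewrite divr_gt0// addr_gt0.
have aM : 0 < a / (M + 1) by rewrite divr_gt0// addr_gt0.
have Ma : 0 < M + 1 + a by rewrite !addr_gt0.
rewrite powRM ?(ltW m0) ?(ltW r0)//.
(* From ln (1 + 1/M) >= 1 / (M + 1) and exp u >= 1 + u. *)
have h : ((M + 1) / M) `^ (- a) <= (M + 1) / (M + 1 + a).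
  have l : a / (M + 1) <= a * ln ((M + 1) / M).
    rewrite ler_wpM2l ?(ltW a0)// -[(M + 1) / M]invf_div.
    rewrite lnV ?posrE ?divr_gt0 ?addr_gt0// lerNr.
    have -> : M / (M + 1) = 1 + - (M + 1)^-1 by field; apply: lt0r_neq0; lra.
    apply: le_ln1Dx; rewrite ltrN2 invf_lt1 ?addr_gt0//; lra.
  have -> : (M + 1) / (M + 1 + a) = (1 + a / (M + 1))^-1.
    by field; do ?[apply/andP; split]; apply: lt0r_neq0; lra.
  rewrite powRN lef_pV2 ?posrE ?powR_gt0 ?addr_gt0//.
  rewrite /powR gt_eqF//; apply: le_trans (expR_ge1Dx _) _.
  by rewrite ler_expR.
rewrite opprD powRD; last by rewrite (gt_eqF m0) implybT.
rewrite powR_inv1 ?(ltW m0)// mulrC -[X in X - _]mulr1 -mulrBr mulrCA.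
apply: ler_wpM2l; first exact: powR_ge0.
apply: (@le_trans _ _ ((2 + a) / a * (1 - (M + 1) / (M + 1 + a)))); last first.
  apply: ler_wpM2l; last by rewrite lerD2l lerN2.
  by rewrite divr_ge0 ?addr_ge0 ?(ltW a0).
have -> : (2 + a) / a * (1 - (M + 1) / (M + 1 + a)) = (2 + a) / (M + 1 + a).
  by field; do ?[apply/andP; split]; apply: lt0r_neq0; lra.
rewrite ler_pdivlMr// mulrC ler_pdivrMr//; nra.
Qed.

Lemma cvg_powR_series (s : R) : 1 < s ->
  cvgn (series (fun n => n.+1%:R `^ (- s) : R)).
Proof.
move=> s1; pose a := s - 1; have a0 : 0 < a by rewrite subr_gt0.
have -> : s = 1 + a by rewrite addrC subrK.
apply: nondecreasing_is_cvgn.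
  move=> m n mn; rewrite -subr_ge0 sub_series_geq//.
  by apply: sumr_ge0 => i _; exact: powR_ge0.
exists ((2 + a) / a) => _ [n _ <-].
have k0 : 0 <= (2 + a) / a by apply: divr_ge0; lra.
apply: (@le_trans _ _ ((2 + a) / a * (1 - n.+1%:R `^ (- a)))).
  elim: n => [|n IH].
    by rewrite /series /= big_geq// powR1 subrr mulr0.
  rewrite seriesSr (le_trans (lerD IH (powR_step n a0)))//.
  by rewrite -mulrDr subrKA.
by rewrite -[leRHS]mulr1 ler_wpM2l// gerBl powR_ge0.
Qed.

Lemma geometric_sum_le (A r : R) m n : 0 <= A -> 0 <= r < 1 ->
  \sum_(m <= i < n) A * r ^+ i <= A * r ^+ m / (1 - r).
Proof.
move=> A0 /andP[r0 r1]; have w0 : 0 < 1 - r by rewrite subr_gt0.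
have [nm|mn] := leqP n m.
  by rewrite big_geq// divr_ge0 ?mulr_ge0 ?exprn_ge0 ?(ltW w0).
rewrite -(subnKC (ltnW mn)); move: (n - m)%N => l.
apply: (@le_trans _ _ (A * r ^+ m / (1 - r) - A * r ^+ (m + l) / (1 - r))).
  elim: l => [|l IH]; first by rewrite addn0 big_geq// subrr.
  rewrite addnS big_nat_recr ?leq_addr//= (le_trans (lerD IH (lexx _)))//.
  rewrite le_eqVlt; apply/orP; left; apply/eqP; rewrite exprS; field.
  exact: lt0r_neq0.
by rewrite gerBl divr_ge0 ?mulr_ge0 ?exprn_ge0 ?(ltW w0).
Qed.

Lemma cvg_real_series (u : R^nat) (A r : R) : 0 <= r < 1 ->
  (forall n, `|u n| <= A * r ^+ n) -> cvgn (series u).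
Proof.
move=> /andP[r0 r1] le; apply: normed_cvg.
apply: (@series_le_cvg _ _ (geometric A r)) => //.
- by move=> n; exact: normr_ge0.
- by move=> n; exact: le_trans (normr_ge0 _) (le n).
- by apply: is_cvg_geometric_series; rewrite ger0_norm.
Qed.

Lemma cseries_lim (u : nat -> R[i]) (A r : R) (M : nat) : 0 < r < 1 ->
  (forall n, (M <= n)%N -> cabs (u n) <= A * r ^+ n) ->
  exists L, cseq_lim (fun n => \sum_(0 <= i < n) u i) L.
Proof.
move=> /andP[r0 r1] le.
(* The added sum makes the geometric bound hold for the finitely many n < M too. *)
pose A' := `|A| + \sum_(i < M) cabs (u i) / r ^+ i.
have s0 : 0 <= \sum_(i < M) cabs (u i) / r ^+ i.
  by apply: sumr_ge0 => i _; rewrite divr_ge0 ?cabs_ge0 ?exprn_ge0 ?(ltW r0).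
have le' n : cabs (u n) <= A' * r ^+ n.
  have [Mn|nM] := leqP M n.
    apply: le_trans (le n Mn) _; apply: ler_wpM2r.
      by rewrite exprn_ge0 ?(ltW r0).
    by rewrite (le_trans (ler_norm A))// lerDl.
  rewrite -ler_pdivrMr ?exprn_gt0//.
  rewrite /A' (bigD1 (Ordinal nM))//= addrCA lerDl addr_ge0//.
  by apply: sumr_ge0 => i _; rewrite divr_ge0 ?cabs_ge0 ?exprn_ge0 ?(ltW r0).
have r01 : 0 <= r < 1 by rewrite ltW.
have cR : cvgn (series (fun n => complex.Re (u n))).
  apply: (@cvg_real_series _ A' _ r01) => n; apply: le_trans (le' n).
  by have [] := cabs_bounds (u n).
have cI : cvgn (series (fun n => complex.Im (u n))).
  apply: (@cvg_real_series _ A' _ r01) => n; apply: le_trans (le' n).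
  by have [] := cabs_bounds (u n).
exists (Complex (limn (series (fun n => complex.Re (u n))))
                (limn (series (fun n => complex.Im (u n))))).
move=> eps eps0; have e2 : 0 < eps / 2 by rewrite divr_gt0.
have /cvgrPdist_lt/(_ _ e2)[N1 _ h1] := cR.
have /cvgrPdist_lt/(_ _ e2)[N2 _ h2] := cI.
exists (maxn N1 N2) => n; rewrite geq_max => /andP[n1 n2].
have := h1 n n1; have := h2 n n2.
rewrite /= distrC [X in _ -> X < _ -> _]distrC.
have -> : \sum_(0 <= i < n) u i =
    Complex (series (fun n => complex.Re (u n)) n)
            (series (fun n => complex.Im (u n)) n).
  rewrite /series /=; elim: n {n1 n2} => [|n IH]; first by rewrite !big_geq.
  by rewrite !big_nat_recr//= IH; case: (u n).
move=> hI hR; apply: le_lt_trans (cabs_le_ReIm _) _ => /=; lra.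
Qed.

End Series.

(** * Rationals close to an irrational *)

Section NearbyRationals.

(* Either parity is available since c = (c - 1) + 1/1. *)
Lemma rat_expansion (p q : nat) (e : bool) : (0 < q < p)%N ->
  exists s c, [/\ all (fun d : int => 0 < d) s, 0 < c, odd (size s) = e &
    p%:R / q%:R = cf_tail s c%:~R :> rat].
Proof.
elim/ltn_ind: q p e => q IH p e /andP[q0 qp].
have q0' : q%:R != 0 :> rat by rewrite pnatr_eq0 -lt0n.
have d0 : (0 < p %/ q)%N by rewrite divn_gt0// ltnW.
have [r0|r0] := posnP (p %% q)%N.
  have pE : p%:R / q%:R = (p %/ q)%:R :> rat.
    by rewrite {1}(divn_eq p q) r0 addn0 natrM mulfK.
  rewrite pE; case: e.
    (* Since p > q, the quotient is at least 2, so its predecessor is an admissible digit before the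
       final 1. *)
    have d1 : (1 < p %/ q)%N.
      move: qp; rewrite {1}(divn_eq p q) r0 addn0.
      by rewrite -[X in (X < _)%N]mul1n ltn_pmul2r.
    exists [:: (p %/ q).-1%:Z], 1; split => //=.
      by rewrite andbT -subn1 ltz_nat subn_gt0.
    by rewrite /cf_tail /= invr1 -{1}(prednK d0) -natr1.
  by exists [::], (p %/ q)%:Z; split => //; rewrite ltz_nat.
have rq : (p %% q < q)%N by rewrite ltn_mod.
have [|s [c [s0 c0 sz e']]] := IH _ rq q (~~ e); first by rewrite r0.
exists ((p %/ q)%:Z :: s), c; split => //=.
- by rewrite ltz_nat d0.
- by rewrite sz negbK.
rewrite /cf_tail /= -/(cf_tail _ _) -e' invf_div.
have r0' : (p %% q)%:R != 0 :> rat by rewrite pnatr_eq0 -lt0n.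
by rewrite {1}(divn_eq p q) natrD natrM mulrDl mulfK.
Qed.

Lemma rat_gt1_expansion (z : rat) (e : bool) : 1 < z ->
  exists s c, [/\ all (fun d : int => 0 < d) s, 0 < c, odd (size s) = e &
    z = cf_tail s c%:~R].
Proof.
move=> z1; have z0 : 0 < z by exact: lt_trans z1.
have dz := denq_gt0 z.
have zE : z = `|numq z|%N%:R / `|denq z|%N%:R.
  rewrite -{1}(divq_num_den z) !pmulrn !gtz0_abs// numq_gt0//.
rewrite zE; apply: rat_expansion; rewrite absz_gt0 denq_neq0 /=.
move: z1; rewrite {1}zE ltr_pdivlMr ?ltr0n ?absz_gt0 ?denq_neq0//.
by rewrite mul1r ltr_nat.
Qed.

Lemma cf_tail_cat (F : fieldType) s s' (z : F) :
  cf_tail (s ++ s') z = cf_tail s (cf_tail s' z).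
Proof. exact: foldr_cat. Qed.

Lemma cylinder_rat (R : realType) b n (y : rat) :
  cylinder b n (rat2R R y) = cylinder b n y.
Proof.
rewrite /cylinder /rat2R.
have -> : ratr y - (cfnum b n.+1)%:~R / (cfden b n.+1)%:~R =
    ratr (y - (cfnum b n.+1)%:~R / (cfden b n.+1)%:~R) :> R.
  by rewrite rmorphB /= fmorph_div /= !ratr_int.
have -> : ((cfden b n.+1)%:~R * ((cfden b n.+1)%:~R + (cfden b n)%:~R))^-1 =
    ratr ((cfden b n.+1)%:~R * ((cfden b n.+1)%:~R + (cfden b n)%:~R))^-1 :> R.
  by rewrite fmorphV rmorphM rmorphD /= !ratr_int.
have -> (z : rat) : (-1) ^+ n * ratr z = ratr ((-1) ^+ n * z) :> R.
  by rewrite rmorphM rmorph_sign.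
by rewrite ltr0q ltr_rat.
Qed.

(** An expansion of the rational complete quotient 1/t is appended to b_0, ..., b_n, its parity
    chosen so that the last index 2l + 1 is odd. *)
Lemma cylinder_rat_expansion b n (y : rat) : cf_digits b -> cylinder b n y ->
  exists b' l, [/\ cf_digits b', forall j, (j <= n)%N -> b' j = b j,
    (n <= l.*2.+1)%N &
    y = (cfnum b' l.*2.+2)%:~R / (cfden b' l.*2.+2)%:~R].
Proof.
move=> hb /(cylinderP hb)[t /andP[t0 t1] yE].
have [|s [c [s0 c0 sz tE]]] := @rat_gt1_expansion t^-1 (odd n).
  by rewrite invf_gt1.
pose L := mkseq b n.+1 ++ rcons s c.
(* The default 1 keeps the digits beyond the end of [L] positive, as [cf_digits] demands. *)
pose b' j := nth 1 L j.
have sL : size L = (n + size s).+2.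
  by rewrite size_cat size_mkseq size_rcons addSn addnS.
have b'b j : (j <= n)%N -> b' j = b j.
  by move=> jn; rewrite /b' nth_cat size_mkseq ltnS jn nth_mkseq.
have hb' : cf_digits b'.
  move=> j; have [jn|nj] := leqP j.+1 n; first by rewrite b'b.
  rewrite /b' nth_cat size_mkseq ltnNge nj /=.
  have [k|k] := ltnP (j.+1 - n.+1) (size (rcons s c)); last first.
    by rewrite nth_default.
  apply: (@all_nthP _ (fun d : int => 0 < d) _ 1 _) => //.
  by rewrite all_rcons c0 s0.
have : ~~ odd (n + size s) by rewrite oddD sz addbb.
move=> /even_halfK; set l := (_)./2 => lE.
exists b', l; split => //; first by rewrite lE leqW// leq_addr.
rewrite -cf_val_mkseq//.
have -> : mkseq b' l.*2.+2 = rcons (mkseq b n.+1 ++ s) c.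
  by rewrite lE -sL mkseq_nth rcons_cat.
by rewrite cf_val_rcons cf_tail_cat -tE.
Qed.

Lemma cylinder_open (R : realType) b n (x : R) : cylinder b n x ->
  exists d, 0 < d /\ forall y, `|y - x| < d -> cylinder b n y.
Proof.
rewrite /cylinder -signr_odd; set u := _ / _; set w := _^-1.
move=> /andP[h1 h2]; set v := (-1) ^+ odd n * (x - u) in h1 h2.
(* The distances from x to the two endpoints of the cylinder. *)
exists (Num.min v (w - v)); rewrite lt_min h1 subr_gt0; split=> // y.
rewrite lt_min !ltr_norml.
move=> /andP[/andP[k1 k2] /andP[k3 k4]].
by move: h1 h2 k1 k2 k3 k4; rewrite /v; case: (odd n);
  rewrite ?expr0 ?expr1 ?mulN1r ?mul1r => *; apply/andP; split; lra.
Qed.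

Lemma rational_near_irrational (R : realType) (x : R) n : irrational x ->
  exists d : R, 0 < d /\ forall y : rat, `|rat2R R y - x| < d ->
    exists b l, [/\ cf_digits b, forall j, (j <= n)%N -> b j = cf_digit x j,
      (n <= l.*2.+1)%N &
      y = (cfnum b l.*2.+2)%:~R / (cfden b l.*2.+2)%:~R].
Proof.
move=> ix; have [d [d0 hd]] := cylinder_open (cylinder_digits n ix).
exists d; split=> // y /hd; rewrite cylinder_rat.
exact/cylinder_rat_expansion/cf_digit_digits.
Qed.

End NearbyRationals.

(** * Bounds on the terms of the series *)

Section TermBounds.
Variables (R : realType) (k : R[i]) (h : R -> R[i]) (b : nat -> int).
Hypothesis k0 : 0 < complex.Re k.
Hypothesis hb : cf_digits b.
Local Notation Q n := ((cfden b n)%:~R : R).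
Local Notation kappa := (complex.Re k).

Lemma norm_cf_ratio n : `|cf_ratio b R n| = Q n.+1 / Q n.+2.
Proof.
rewrite /cf_ratio normrM normr_sign mul1r gtr0_norm// divr_gt0// ltr0z.
  exact: cfden_gt0.
exact: cfden_gt0.
Qed.

Lemma cabs_cf_term n : cabs (cf_term k h b n) =
  Q n.+2 `^ (- kappa) * cabs (h (cf_ratio b R n)).
Proof.
rewrite /cf_term cabsM cabs_cpow ?ltr0z ?cfden_gt0//.
by case: (k).
Qed.

Lemma cf_ratio_bounds n : 0 < `|cf_ratio b R n| <= 1.
Proof.
have q1 : 0 < Q n.+1 by rewrite ltr0z cfden_gt0.
have q2 : 0 < Q n.+2 by rewrite ltr0z cfden_gt0.
by rewrite norm_cf_ratio divr_gt0//= ler_pdivrMr// mul1r ler_int cfden_le.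
Qed.

(** The base is (3/2)^(-Re k), and [cfden_growth] at n + 1 gives q_{n+1} >= (3/2)^n. *)
Lemma cfden_powR_le n :
  Q n.+2 `^ (- kappa) <= expR (- (kappa * ln (3 / 2))) ^+ n.
Proof.
have q2 : 0 < Q n.+2 by rewrite ltr0z cfden_gt0.
have a0 : 0 < 3 / 2 :> R by lra.
have le : (3 / 2) ^+ n <= Q n.+2.
  have := cfden_growth hb R n.+1; rewrite exprS ler_pM2l//.
rewrite /powR gt_eqF// -expRM_natl ler_expR mulNr mulrN lerN2 mulrCA.
rewrite ler_wpM2l ?(ltW k0)// [n%:R * _]mulr_natl -lnXn// ler_ln// posrE.
exact: exprn_gt0.
Qed.

(** At the ratio q_{n+1} / q_{n+2} the bound on [h] turns q_{n+2}^(-Re k) into q_{n+1}^(-Re k); the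
    result does not depend on the digits. *)
Lemma cf_term_le_geometric C : (forall x, 0 < `|x| <= 1 ->
     cabs (h x) <= C * `|x| `^ (- kappa)) ->
  forall n, cabs (cf_term k h b n.+1) <=
    C * expR (- (kappa * ln (3 / 2))) ^+ n.
Proof.
move=> hC n.
have C0 : 0 <= C.
  have := hC 1; rewrite normr1 ltr01 lexx powR1 mulr1 => /(_ isT).
  exact/le_trans/cabs_ge0.
have q1 : 0 < Q n.+2 by rewrite ltr0z cfden_gt0.
have q2 : 0 < Q n.+3 by rewrite ltr0z cfden_gt0.
rewrite cabs_cf_term.
apply: (@le_trans _ _ (C * Q n.+2 `^ (- kappa))); last first.
  by apply: ler_wpM2l => //; exact: cfden_powR_le.
have := hC _ (cf_ratio_bounds n.+1); rewrite norm_cf_ratio => hle.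
apply: le_trans (ler_wpM2l (powR_ge0 _ _) hle) _.
rewrite mulrCA -powRM ?(ltW q2) ?divr_ge0 ?(ltW q1) ?(ltW q2)//.
by rewrite [Q n.+3 * _]mulrC divfK ?lt0r_neq0.
Qed.

(** With c = Re k ln(3/2) / 2, the decay exp(-2 c n) of q_{n+1}^(-Re k) beats the growth exp(c (n +
    1)) of [h]: the product is exp(c) exp(-c n). *)
Lemma cf_term_le_small_tail (C eta : R) n : 0 < eta -> 0 <= C ->
  cabs (h (cf_ratio b R n)) <= C * expR (`|cf_ratio b R n| `^ (- eta)) ->
  (Q n.+2 / Q n.+1) `^ eta <= kappa * ln (3 / 2) / 2 * n.+1%:R ->
  cabs (cf_term k h b n) <=
    C * expR (kappa * ln (3 / 2) / 2) * expR (- (kappa * ln (3 / 2) / 2)) ^+ n.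
Proof.
move=> eta0 C0 hle hr; rewrite cabs_cf_term.
have q1 : 0 < Q n.+1 by rewrite ltr0z cfden_gt0.
have q2 : 0 < Q n.+2 by rewrite ltr0z cfden_gt0.
set c := kappa * ln (3 / 2) / 2 in hr *.
have cE : kappa * ln (3 / 2) = c + c by rewrite /c; field.
apply: le_trans (ler_pM (powR_ge0 _ _) (cabs_ge0 _) (cfden_powR_le n) hle) _.
rewrite mulrCA -mulrA ler_wpM2l// cE -!expRM_natl -!expRD ler_expR.
suff : `|cf_ratio b R n| `^ (- eta) <= c * n.+1%:R.
  by rewrite -natr1; lra.
rewrite norm_cf_ratio -invf_div -powR_inv1 ?divr_ge0 ?(ltW q1) ?(ltW q2)//.
by rewrite -powRrM mulN1r opprK.
Qed.

End TermBounds.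

(** * The limit *)

Section Limits.
Variables (R : realType) (k : R[i]) (delta : R).
Variables (f : rat -> R[i]) (h : R -> R[i]).
Hypothesis k0 : 0 < complex.Re k.
Hypothesis delta0 : 0 < delta.
Hypothesis periodic : forall x : rat, ~ (-1 <= x <= 0) -> f x = f (x + 1).
Hypothesis reciprocity : forall x : rat, x != 0 ->
  h (rat2R R x) = f x - cpow `|rat2R R x| (- k) * f (- x^-1).

Let c : R := complex.Re k * ln (3 / 2) / 2.
(** Stands for 1 - delta; capping delta at 1/2 keeps it positive, and the growth bound on [h] only
    weakens since |x| < 1. *)
Let eta : R := 1 - Num.min delta (1 / 2).

(* If t_n > tail_threshold n then q_{n+1} / q_n <= 2 / t_n <= (c (n+1))^{1/eta},
   so exp((q_{n+1} / q_n)^eta) <= (3/2)^{Re k (n+1) / 2}, which q_{n+1}^{-Re k}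
   beats; the thresholds are summable since 1/eta > 1. *)
Definition tail_threshold n : R := 2 * (c * n.+1%:R) `^ (- eta^-1).

Lemma log_rate_gt0 : 0 < c.
Proof. by rewrite /c divr_gt0// mulr_gt0// ln_gt0//; lra. Qed.

Lemma eta_bounds : 0 < eta < 1.
Proof.
have m0 : 0 < Num.min delta (1 / 2) by rewrite lt_min delta0; lra.
have m1 : Num.min delta (1 / 2) <= 1 / 2 by rewrite ge_min lexx orbT.
by rewrite /eta; apply/andP; split; lra.
Qed.

Lemma tail_threshold_ge0 n : 0 <= tail_threshold n.
Proof. by rewrite mulr_ge0// powR_ge0. Qed.

Lemma cvg_tail_threshold : cvgn (series tail_threshold).
Proof.
have /andP[e0 e1] := eta_bounds.
have -> : tail_threshold =
    (2 * c `^ (- eta^-1)) *: (fun n => n.+1%:R `^ (- eta^-1) : R).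
  apply/funext => n; rewrite /tail_threshold powRM ?ler0n ?(ltW log_rate_gt0)//.
  by rewrite mulrA.
apply: is_cvg_seriesZ; apply: cvg_powR_series.
by rewrite invf_gt1.
Qed.

Lemma fstar_seqE x j : irrational x ->
  fstar_seq k f x j = cf_sum k f h (cf_digit x) j.*2.+1.
Proof.
move=> ix; have hb := cf_digit_digits ix.
apply: (fstar_value periodic reciprocity hb).
by rewrite /convergent mul2n -cf_val_mkseq.
Qed.

(** Terms of index below n involve only q_0, ..., q_n, hence only b_1, ..., b_n. *)
Lemma eq_cf_sum b b' n : (forall j, (j <= n)%N -> b j = b' j) ->
  cf_sum k f h b n = cf_sum k f h b' n.
Proof.
move=> e; congr (_ + _); apply: eq_big_nat => i /andP[_ ip].
have eQ m : (m <= n.+1)%N -> cfden b m = cfden b' m.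
  move=> mn; apply: eq_continuant => j /andP[_ jm].
  by apply: e; rewrite -ltnS (leq_trans jm).
by rewrite /cf_term /cf_ratio !eQ// ltnW.
Qed.

Lemma partial_quotient_bound x n : irrational x ->
  tail_threshold n < gauss_iter x n ->
  ((cfden (cf_digit x) n.+2)%:~R / (cfden (cf_digit x) n.+1)%:~R) `^ eta
    <= c * n.+1%:R.
Proof.
move=> ix ht; have hb := cf_digit_digits ix.
have /andP[eta0 eta1] := eta_bounds.
have /andP[t0 t1] := gauss_iter_bounds n ix.
have /andP[t0' _] := gauss_iter_bounds n.+1 ix.
have q1 : 0 < (cfden (cf_digit x) n.+1)%:~R :> R by rewrite ltr0z cfden_gt0.
have q2 : 0 < (cfden (cf_digit x) n.+2)%:~R :> R by rewrite ltr0z cfden_gt0.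
have cn0 : 0 < c * n.+1%:R by rewrite mulr_gt0 ?log_rate_gt0.
have q01 : (cfden (cf_digit x) n)%:~R / (cfden (cf_digit x) n.+1)%:~R <= 1 :> R.
  by rewrite ler_pdivrMr// mul1r ler_int cfden_le.
(* q_{n+1} / q_n = b_{n+1} + q_{n-1} / q_n <= 1/t_n + 1, and 1 < 1/t_n. *)
have le1 : (cfden (cf_digit x) n.+2)%:~R / (cfden (cf_digit x) n.+1)%:~R <=
    2 * (gauss_iter x n)^-1.
  rewrite cfdenSS intrD intrM mulrDl mulfK ?lt0r_neq0//.
  have := cf_digitS x n; have : 1 < (gauss_iter x n)^-1 by rewrite invf_gt1.
  lra.
have le2 : 2 * (gauss_iter x n)^-1 <= (c * n.+1%:R) `^ eta^-1.
  rewrite ler_pdivrMr// -ler_pdivrMl ?powR_gt0// mulrC -powRN.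
  exact: ltW.
apply: (@le_trans _ _ (((c * n.+1%:R) `^ eta^-1) `^ eta)).
  apply: ge0_ler_powR; rewrite ?nnegrE ?(ltW eta0) ?powR_ge0 ?divr_ge0//;
    try exact: ltW.
  exact: le_trans le2.
by rewrite -powRrM mulVf ?lt0r_neq0// powRr1// ltW.
Qed.

Lemma fstar_cvg (C : R) x :
  (forall x : R, 0 < `|x| < 1 ->
     cabs (h x) <= C * expR (`|x| `^ (-1 + delta))) ->
  irrational x ->
  (exists M, forall n, (M <= n)%N -> tail_threshold n < gauss_iter x n) ->
  exists L, cseq_lim (fstar_seq k f x) L.
Proof.
move=> hC ix [M hM]; have hb := cf_digit_digits ix.
have /andP[eta0 eta1] := eta_bounds.
have C0 : 0 <= C.
  have /hC le : 0 < `|1 / 2 : R| < 1 by rewrite ger0_norm; lra.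
  by have := le_trans (cabs_ge0 _) le; rewrite pmulr_lge0// expR_gt0.
have r01 : 0 < expR (- c) < 1.
  by rewrite expR_gt0 expR_lt1 oppr_lt0 log_rate_gt0.
(* Index 0 is skipped because q_0 / q_1 = 1 when b_1 = 1, outside the range of the bound on [h];
   later ratios are below 1. *)
have [|L hL] := @cseries_lim _ (cf_term k h (cf_digit x)) (C * expR c) _
    (maxn M 1) r01.
  move=> n; rewrite geq_max => /andP[Mn n1].
  apply: (cf_term_le_small_tail k0 hb eta0 C0); last first.
    exact: (partial_quotient_bound ix (hM n Mn)).
  have /andP[x0 x1] := cf_ratio_bounds R hb n.
  have x1' : `|cf_ratio (cf_digit x) R n| < 1.
    rewrite norm_cf_ratio// ltr_pdivrMr ?ltr0z ?cfden_gt0// mul1r ltr_int.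
    by case: n n1 {Mn x0 x1} => // n _; exact: cfden_lt.
  have /hC/le_trans -> // : 0 < `|cf_ratio (cf_digit x) R n| < 1 by rewrite x0.
  (* As |x| <= 1, |x|^(-1 + delta) <= |x|^(-eta) follows from -eta <= -1 + delta. *)
  apply: ler_wpM2l => //; rewrite ler_expR; apply: ger_powR.
    by rewrite x0 x1.
  by rewrite /eta opprB addrC lerD2l ge_min lexx.
exists (f (-1) + L) => eps /hL[N hN]; exists N => j Nj.
rewrite fstar_seqE// /cf_sum opprD addrACA subrr add0r; apply: hN.
by rewrite leqW// (leq_trans Nj)// -addnn leq_addr.
Qed.

(** The partial sums for y and x up to index 2j + 1 agree, and that of x is eps/2-close to L; the
    rest of the sum for y is a geometric tail, bounded uniformly in its digits. *)
Lemma fstar_rat_lim (C : R) x L :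
  (forall x : R, 0 < `|x| <= 1 -> cabs (h x) <= C * `|x| `^ (- complex.Re k)) ->
  irrational x -> cseq_lim (fstar_seq k f x) L -> rat_lim k f x L.
Proof.
move=> hC ix hL eps eps0.
set r := expR (- (complex.Re k * ln (3 / 2))).
have ln0 : 0 < ln (3 / 2) :> R by rewrite ln_gt0//; lra.
have r0 : 0 < r by exact: expR_gt0.
have r1 : r < 1 by rewrite expR_lt1 oppr_lt0 mulr_gt0.
have C0 : 0 <= C.
  have := hC 1; rewrite normr1 ltr01 lexx powR1 mulr1 => /(_ isT).
  exact/le_trans/cabs_ge0.
have e2 : 0 < eps / 2 by rewrite divr_gt0.
have [N hN] := hL _ e2.
have [M hM] : exists M, forall n, (M <= n)%N -> C * r ^+ n / (1 - r) < eps / 2.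
  have [->|Cn] := eqVneq C 0; first by exists 0 => n _; rewrite !mul0r.
  have Cp : 0 < C by rewrite lt_neqAle eq_sym Cn.
  have e3 : 0 < eps / 2 * (1 - r) / C by rewrite divr_gt0// mulr_gt0// subr_gt0.
  have /cvgrPdist_lt/(_ _ e3)[M _ hM] : (GRing.exp r @ \oo --> 0)%classic.
    by apply: cvg_expr; rewrite ger0_norm// ltW.
  exists M => n /hM /=; rewrite sub0r normrN ger0_norm ?exprn_ge0 ?(ltW r0)//.
  by rewrite ltr_pdivlMr// ltr_pdivrMr ?subr_gt0// mulrC.
pose j := maxn N M; have [d [d0 hd]] := rational_near_irrational j.*2.+1 ix.
exists d; split=> // y /andP[_ /hd [b [l [hb bE jl yE]]]].
rewrite (fstar_value periodic reciprocity hb yE).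
have := hN j (leq_maxl _ _); rewrite fstar_seqE// -(eq_cf_sum bE).
have tail : cabs (cf_sum k f h b l.*2.+1 - cf_sum k f h b j.*2.+1) < eps / 2.
  have -> : cf_sum k f h b l.*2.+1 - cf_sum k f h b j.*2.+1 =
      \sum_(j.*2.+1 <= i < l.*2.+1) cf_term k h b i.
    rewrite /cf_sum (big_cat_nat (leq0n j.*2.+1) jl)/=.
    by ring.
  apply: le_lt_trans (cabs_sum _ _) _.
  (* Shifts the index to match [cf_term_le_geometric], which bounds the term n + 1 by C r^n. *)
  rewrite big_add1 /=.
  apply: (@le_lt_trans _ _ (\sum_(j.*2 <= i < l.*2) C * r ^+ i)).
    by apply: ler_sum => i _; exact: cf_term_le_geometric.
  apply: le_lt_trans (geometric_sum_le _ _ C0 _) _; first by rewrite ltW.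
  by apply: hM; rewrite (leq_trans (leq_maxr N M))// -addnn leq_addr.
move=> near.
rewrite -[X in X - L](subrK (cf_sum k f h b j.*2.+1)) -addrA.
by apply: le_lt_trans (cabsD _ _) _; lra.
Qed.

End Limits.

Local Open Scope classical_set_scope.

Theorem theorem1p5 (R : realType) (k : R[i]) (delta : R)
  (f : rat -> R[i]) (h : R -> R[i]) :
  0 < complex.Re k -> 0 < delta ->
  (forall x : rat, ~ (-1 <= x <= 0) -> f x = f (x + 1)) ->
  (forall x : rat, x != 0 ->
     h (rat2R R x) = (f x - cpow `|rat2R R x| (- k) * f (- x^-1))%C) ->
  (exists C : R, forall x : R, 0 < `|x| < 1 ->
     cabs (h x) <= C * expR (`|x| `^ (-1 + delta))) ->
  exists X : set R,
    (@lebesgue_measure R).-negligible (~` X) /\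
    (forall x, X x -> exists L : R[i], cseq_lim (fstar_seq k f x) L) /\
    ((forall x : rat, f x = f (x + 1)) ->
     (exists C : R, forall x : R, 0 < `|x| <= 1 ->
        cabs (h x) <= C * `|x| `^ (- complex.Re k)) ->
     forall x, X x -> irrational x ->
       forall L : R[i], cseq_lim (fstar_seq k f x) L -> rat_lim k f x L).
Proof.
move=> k0 delta0 periodic reciprocity [C hC].
(* The irrationals whose Gauss iterates eventually exceed the summable thresholds, so that large
   digits cannot spoil convergence. *)
exists [set x | irrational x /\ exists M, forall n, (M <= n)%N ->
  tail_threshold k delta n < gauss_iter x n].
split; last split.
- apply: negligible_small_tails; first exact: tail_threshold_ge0.
  exact: cvg_tail_threshold.
- by move=> x [ix hx]; apply: (fstar_cvg k0 delta0 periodic reciprocity hC).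
- move=> _ [C' hC'] x _ ix L.
  exact: (fstar_rat_lim k0 periodic reciprocity hC').
Qed.
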